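(* Let $(X,\mu,W)$ be a homogeneous path-connected topological design problem with $M>1$. Then for every integer $N>M(M-1)$ there exists a design for $(X,\mu,W)$ of size $N$. Furthermore, there exists a design for $(X,\mu,W)$ of size at most $M(M-1)$.
   Context: A topological design problem is a triple $(X,\mu,W)$ where $X$ is a topological space with its Borel $\sigma$-algebra, $\mu$ is a positive measure on it with $\mu(X)=1$, and $W$ is a finite-dimensional real vector space of bounded continuous functions $X\to\mathbb{R}$. It is path-connected if $X$ is path-connected. It is homogeneous if for every $x,y\in X$ there is a measure-preserving homeomorphism $\phi:X\to X$ with $\phi^*(W)=W$ (where $\phi^*(W)=\{f\circ\phi: f\in W\}$) and $\phi(x)=y$. A design of size $N$ ($N\ge1$) is a list of $N$ points $p_1,\dots,p_N\in X$ (not necessarily distinct) with $\int_X f\,d\mu=\frac1N\sum_{i=1}^N f(p_i)$ for all $f\in W$. Let $V$ be the space of all $f\in W+\langle 1\rangle$ (where $1$ is the constant function) with $\int_X f\,d\mu=0$, and let $M=\dim V$. *)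

(* Defs.v *)
From HB Require Import structures.
From mathcomp Require Import all_boot all_order all_algebra.
From mathcomp Require Import all_classical all_reals all_analysis.

Set Implicit Arguments.
Unset Strict Implicit.
Unset Printing Implicit Defensive.

Import Order.TTheory GRing.Theory Num.Theory.
Import numFieldNormedType.Exports.

Local Open Scope classical_set_scope.
Local Open Scope ring_scope.

(* The points of [X], equipped with the Borel sigma-algebra. *)
Definition borel (X : ptopologicalType) := g_sigma_algebraType (@open X).

Definition subspace_of (R : realType) (E : lmodType R) (W : set E) : Prop :=
  [/\ W 0, forall f g, W f -> W g -> W (f + g)
    & forall (a : R) f, W f -> W (a *: f)].

Definition lin_span (R : realType) (E : lmodType R) (n : nat)
    (b : 'I_n -> E) : set E :=
  [set \sum_(i < n) c i *: b i | c in [set: 'I_n -> R]].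

Definition lin_free (R : realType) (E : lmodType R) (n : nat)
    (b : 'I_n -> E) : Prop :=
  forall c : 'I_n -> R, \sum_(i < n) c i *: b i = 0 -> forall i, c i = 0.

(* [W] is a subspace with a basis of [n] vectors.  This is a relation because
   the ambient function space is not a [vectType], so [\dim] does not apply. *)
Definition has_dim (R : realType) (E : lmodType R) (W : set E) (n : nat) : Prop :=
  exists b : 'I_n -> E, lin_free b /\ W = lin_span b.

(* That the space is pointed only says that it is nonempty, which also follows
   from [dp_mu] having total mass 1. *)
Record design_problem (R : realType) := DesignProblem {
  dp_space :> ptopologicalType ;
  dp_mu : probability (borel dp_space) R ;
  dp_W : set (dp_space -> R) ;
  dp_W_subspace : subspace_of dp_W ;
  dp_W_findim : exists n, has_dim dp_W n ;
  dp_W_continuous : forall f, dp_W f -> continuous f ;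
  dp_W_bounded : forall f, dp_W f -> bounded_fun f
}.

Arguments dp_mu {R} d.
Arguments dp_W {R} d _ : rename.

Definition path_connected (R : realType) (X : topologicalType) : Prop :=
  forall x y : X, exists gamma : R -> X,
    [/\ {within `[0, 1]%classic, continuous gamma}, gamma 0 = x & gamma 1 = y].

Definition homeomorphism (X Y : topologicalType) (phi : X -> Y) : Prop :=
  continuous phi /\
  exists psi : Y -> X, [/\ cancel phi psi, cancel psi phi & continuous psi].

Definition measure_preserving (R : realType) (X : ptopologicalType)
    (mu : probability (borel X) R) (phi : X -> X) : Prop :=
  forall A : set (borel X), measurable A -> mu (phi @^-1` A) = mu A.

Definition homogeneous (R : realType) (D : design_problem R) : Prop :=
  forall x y : D, exists phi : D -> D,
    [/\ homeomorphism phi, measure_preserving (dp_mu D) phi,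
        [set f \o phi | f in dp_W D] = dp_W D & phi x = y].

Definition is_design (R : realType) (D : design_problem R) (N : nat)
    (p : 'I_N -> D) : Prop :=
  (0 < N)%N /\
  forall f, dp_W D f ->
    \int[dp_mu D]_x f x = N%:R^-1 * \sum_(i < N) f (p i).

Definition dp_V (R : realType) (D : design_problem R) : set (D -> R) :=
  [set h | (exists f (c : R), dp_W D f /\ h = (fun x => f x + c)) /\
           \int[dp_mu D]_x h x = 0].

Arguments dp_V {R} D _.

(* Main.v *)
Require Import Defs.
From mathcomp Require Import all_boot all_order all_algebra.
From mathcomp Require Import all_classical all_reals all_analysis.
From mathcomp Require Import measurable_realfun ring lra zify.

(** Write [E = (b_1, ..., b_M) : X -> R^M] for a basis [b] of [V]; a design is a
list of points at which the values of [E] sum to 0.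

Suppose that [- inf f <= kappa * sup f] for all [f] in [V].  Then a design of
size [N] exists as soon as [N > (M - 1) (1 + kappa)].  It suffices to find
points [p_1(f), ..., p_N(f)] depending continuously on [f] in the cube
[[-1, 1]^M] of [V] such that [f(p_1(f)) + ... + f(p_N(f)) > 0] on the boundary:
the vector field [f |-> E(p_1(f)) + ... + E(p_N(f))] then has a zero, by the
Poincare-Miranda theorem.  Cut the cube into small cells by [N] mutually shifted
grids; let [p_i(f)] almost maximise [f] well inside the cells of the [i]-th
grid, and run along a path to a base point near their walls.  For a given
direction the walls of distinct grids are disjoint, and a boundary point of the
cube is away from all the walls in one of the [M] directions, so that at most
[M - 1] of the [p_i(f)] are off their almost maximal position there.

By Fenchel's theorem 0 is a convex combination of at most [M] points of the
path-connected set [E(X)].  Homogeneity moves the point of largest weight, which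
is at least [1 / M], anywhere in [X]; this gives [kappa <= M - 1], strictly
unless all the weights are equal, when these points form a design. *)

Set Implicit Arguments.
Unset Strict Implicit.
Unset Printing Implicit Defensive.

Import Order.TTheory GRing.Theory Num.Theory.
Import numFieldNormedType.Exports.

Local Open Scope ring_scope.

(** * A parity argument on cubical grids *)

Lemma addF2 (x : 'F_2) : x + x = 0.
Proof. by rewrite -mulr2n -mulr_natr pchar_Zp ?mulr0. Qed.

(** The pairs [(x, y)] and [(y, x)] carry equal terms, which cancel mod 2; ranks in the enumeration
    of [T] tell the two orders apart. *)
Lemma sum_sym_F2 (T : finType) (D : {set T}) (g : T -> T -> 'F_2) :
  (forall x y, g x y = g y x) ->
  \sum_(x in D) \sum_(y in D :\ x) g x y = 0.
Proof.
move=> gC; rewrite pair_big_dep /=.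
pose r (p : T * T) := (enum_rank p.1 < enum_rank p.2)%N.
rewrite (bigID r) /=.
set S := (X in _ + X); rewrite (_ : S =
  \sum_(p | (p.1 \in D) && (p.2 \in D :\ p.1) && r p) g p.1 p.2) ?addF2 //.
pose swap (p : T * T) := (p.2, p.1).
have swapK : involutive swap by case.
rewrite /S (reindex_inj (inv_inj swapK)) /=.
apply: eq_big => [[x y]|[x y] _] /=; last exact: gC.
rewrite !inE /r /= -leqNgt leq_eqVlt.
case: (eqVneq x y) => [->|xy]; first by rewrite !andbF.
have -> : ((enum_rank x : nat) == enum_rank y) = false.
  by apply/negbTE; apply: contra xy => /eqP/val_inj/enum_rank_inj ->.
by rewrite /= [(x \in D) && _]andbC.
Qed.

Section CubicalParity.
Variables (M : nat) (s : nat -> ('I_M -> nat) -> 'F_2).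
Implicit Types (v : 'I_M -> nat) (D A : {set 'I_M}).

Definition shift v D : 'I_M -> nat := fun i => (v i + (i \in D))%N.

(* Mod 2 cubical cup product of the coboundaries of s 0, ..., s k.-1,
   evaluated on the cube with lowest vertex v and set of directions D. *)
Fixpoint cup k v D : 'F_2 :=
  if k is k'.+1 then
    \sum_(d in D) (s k' (shift v D) + s k' (shift v (D :\ d)))
      * cup k' v (D :\ d)
  else 1.

Lemma shift1D v D d : d \in D -> shift (shift v [set d]) (D :\ d) =1 shift v D.
Proof.
move=> dD i; rewrite /shift !inE -addnA; congr addn.
by case: eqVneq => [->|_] //=; rewrite dD.
Qed.

Hypothesis s_ext : forall k v v', v =1 v' -> s k v = s k v'.

Lemma eq_shift v v' D : v =1 v' -> shift v D =1 shift v' D.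
Proof. by move=> e i; rewrite /shift e. Qed.

Lemma eq_cup k v v' D : v =1 v' -> cup k v D = cup k v' D.
Proof.
move=> e; elim: k D => //= k IH D; apply: eq_bigr => d _.
by rewrite IH !(s_ext _ (eq_shift _ e)).
Qed.

(** The two summands belong to the opposite faces of the cube normal to [d]: this says that the mod
    2 coboundary of [cup k] is zero. *)
Definition cup_cocycle k := forall v D,
  \sum_(d in D) (cup k v (D :\ d) + cup k (shift v [set d]) (D :\ d)) = 0.

(* The coboundary of cup k times s k. *)
Lemma cup_coboundary k v D : cup_cocycle k ->
  cup k.+1 v D = \sum_(d in D)
     (s k (shift v (D :\ d)) * cup k v (D :\ d) +
      s k (shift v D) * cup k (shift v [set d]) (D :\ d)).
Proof.
move=> coc; apply/eqP; rewrite -subr_eq0 oppr_pchar2 ?pchar_Fp // -big_split /=.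
rewrite -[X in _ == X](mulr0 (s k (shift v D))) -[in X in _ == X](coc v D)
  mulr_sumr.
apply/eqP/eq_bigr => d _; rewrite mulrDl mulrDr addrA; congr (_ + _).
by rewrite -addrA addF2 addr0.
Qed.

(** By [cup_coboundary], [cup k.+1] is itself a coboundary; taking a second coboundary meets every
    face of codimension 2 twice. *)
Lemma cup_is_cocycle k : cup_cocycle k.
Proof.
elim: k => [|k IH] v D; first by rewrite big1 // => d _; rewrite addF2.
under eq_bigr => d dD do rewrite !(cup_coboundary _ _ IH) -big_split /=.
pose b v' D' := s k (shift v' D') * cup k v' D'.
pose sh v d := shift v [set d].
(* The total over the four faces of codimension 2 normal to [d] and [d'], symmetric in the two
   directions. *)
pose g d d' := (b v (D :\ d :\ d') + b (sh (sh v d) d') (D :\ d :\ d')) +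
               (b (sh v d) (D :\ d :\ d') + b (sh v d') (D :\ d :\ d')).
rewrite -[RHS](@sum_sym_F2 _ D g); last first.
  move=> x y; rewrite /g.
  have -> : D :\ x :\ y = D :\ y :\ x.
    by apply/setP => i; rewrite !inE; do 2 case: (_ == _).
  rewrite [b (sh v x) _ + _]addrC; congr (_ + _ + _).
  have e : sh (sh v x) y =1 sh (sh v y) x.
    by move=> i; rewrite /sh /shift addnAC.
  by rewrite /b (eq_cup _ _ e) (s_ext _ (eq_shift _ e)).
apply: eq_bigr => d dD; apply: eq_bigr => d' dD'; rewrite /g /b.
rewrite (s_ext _ (shift1D v dD')) (s_ext _ (shift1D (sh v d) dD')).
set a1 := s k _ * _; set a2 := s k _ * _; set a3 := s k _ * _;
  set a4 := s k _ * _.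
by rewrite addrACA [a2 + a4]addrC addrACA [a3 + a2]addrC -!addrA;
  congr (_ + _); rewrite addrCA.
Qed.

(** A difference of [s j] along an edge of the cube is a factor of every term of the expanded
    product, and it is [a + a = 0]. *)
Lemma cup_eq0 j k v D a : (j < k)%N ->
  (forall A, A \subset D -> s j (shift v A) = a) -> cup k v D = 0.
Proof.
elim: k D => // k IH D; rewrite ltnS leq_eqVlt => /predU1P[->|jk] sa.
  by rewrite /= big1 // => d _; rewrite !sa ?subD1set // addF2 mul0r.
rewrite /= big1 // => d _; rewrite IH ?mulr0 // => A AD.
by apply: sa; apply: fintype.subset_trans AD (subD1set _ _).
Qed.

End CubicalParity.

Section Telescope.
Variables (M n : nat).
Implicit Types (d : 'I_M) (u : {ffun 'I_M -> 'I_n.+1}).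

Definition ordval u : 'I_M -> nat := fun i => u i.

(** Along each line of direction [d] an inner vertex ends two edges and cancels mod 2; only the two
    end vertices survive. [Q] selects the lines. *)
Lemma telescope_F2 (g : ('I_M -> nat) -> 'F_2) (q : 'I_M -> pred nat) d :
  (forall v v', v =1 v' -> g v = g v') -> (0 < n)%N ->
  let Q u := [forall i, (i != d) ==> q i (u i)] in
  \sum_(u | Q u && (u d < n)%N) (g (ordval u) + g (shift (ordval u) [set d])) =
  \sum_(u | Q u && (u d == 0 :> nat)) g (ordval u)
    + \sum_(u | Q u && (u d == n :> nat)) g (ordval u).
Proof.
move=> gE n0 Q; rewrite big_split /=.
pose upd u k : {ffun 'I_M -> 'I_n.+1} :=
  [ffun i => if i == d then inord k else u i].
have Qupd u k : Q (upd u k) = Q u.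
  by apply: eq_forallb => i; rewrite ffunE; case: eqVneq.
have -> : \sum_(u | Q u && (u d < n)%N) g (shift (ordval u) [set d]) =
          \sum_(u | Q u && (0 < u d)%N) g (ordval u).
  rewrite [RHS](reindex_onto (fun u => upd u (u d).+1)
                             (fun u => upd u (u d).-1)) /=.
    apply: eq_big => [u|u /andP[_ ud]].
      rewrite Qupd -andbA; congr andb; rewrite ffunE eqxx.
      case: (ltnP (u d) n) => ud.
        rewrite inordK ?ltnS //=; apply/esym/eqP/ffunP => i.
        rewrite !ffunE ?eqxx; case: eqVneq => [->|] //.
        by apply/val_inj; rewrite /= inordK // ltnW.
      (* Here [inord n.+1] is a default element [z]; undoing the shift would force [z.-1 = n], which
         is out of range. *)
      have {}ud : val (u d) = n by apply/eqP; rewrite eqn_leq ud -ltnS ltn_ord.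
      rewrite /= ud; apply/esym/negP => /andP[z0 /eqP/ffunP/(_ d)].
      rewrite !ffunE ?eqxx => /(congr1 val) /=.
      move: (inord n.+1) z0 => z z0.
      rewrite ud inordK ?prednK // => [zn|]; last by rewrite ltnW.
      by have := ltn_ord z; rewrite ltnS -(prednK z0) zn ltnn.
    apply: gE => i; rewrite /shift /ordval ffunE inE; case: eqVneq => [->|_];
      last by rewrite addn0.
    by rewrite inordK ?ltnS // addn1.
  move=> u /andP[_ u0]; apply/ffunP => i; rewrite !ffunE eqxx.
  case: eqVneq => [->|] //.
  by rewrite inordK ?prednK ?inord_val // ltnW.
rewrite (bigID (fun u => u d == 0%N :> nat)) /=.
rewrite [X in _ + X](bigID (fun u => u d == n :> nat)) /= addrACA.
rewrite [X in _ + X](_ : _ = 0) ?addr0; last first.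
  rewrite -[RHS](addF2 (\sum_(u | Q u && ((0 < u d) && (u d < n))%N)
    g (ordval u))).
  congr (_ + _); apply: eq_bigl => u; rewrite -!andbA; case: (Q u) => //=.
    by rewrite lt0n andbC.
  by congr andb; rewrite ltn_neqAle -ltnS ltn_ord andbT.
congr (_ + _); apply: eq_bigl => u; rewrite -!andbA; case: (Q u) => //=.
  by case: eqP => [->|]; rewrite ?n0 ?andbF.
by case: eqP => [->|]; rewrite ?n0 ?andbF.
Qed.

End Telescope.

Section Cell.
Variables (M n : nat) (s : nat -> ('I_M -> nat) -> 'F_2).
Hypothesis n0 : (0 < n)%N.
Hypothesis s_ext : forall k v v', v =1 v' -> s k v = s k v'.
Hypothesis s_lo : forall (j : 'I_M) v, v j = 0%N -> s j v = 0.
Hypothesis s_hi : forall (j : 'I_M) v, v j = n -> s j v = 1.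

(** A discrete Stokes formula: [cup k.+1] is the coboundary of [s k] times [cup k], so its sum over
    the cells of a face of the grid reduces to that face's boundary, where the sum for [k]
    reappears. *)
Lemma sum_cup k : (k <= M)%N ->
  \sum_(u : {ffun 'I_M -> 'I_n.+1} |
        [forall i : 'I_M, if (i < k)%N then (u i < n)%N else (u i == n :> nat)])
    cup s k (ordval u) [set i : 'I_M | (i < k)%N] = 1.
Proof.
elim: k => [_|k IH kM].
  rewrite (big_pred1 [ffun=> ord_max]) // => u;
    apply/forallP/eqP => [un|-> i] /=.
    by apply/ffunP => i; rewrite ffunE; apply/val_inj/eqP/un.
  by rewrite ffunE.
pose b D v := s k (shift v D) * cup s k v D.
have bE D v v' : v =1 v' -> b D v = b D v'.
  by move=> e; rewrite /b (eq_cup s_ext _ _ e) (s_ext _ (eq_shift _ e)).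
set D := [set i : 'I_M | (i < k.+1)%N].
pose kk : 'I_M := Ordinal kM.
under eq_bigr => u _.
  rewrite (cup_coboundary _ _ (cup_is_cocycle s_ext k)).
  under eq_bigr => d dD.
    rewrite -(s_ext _ (shift1D (ordval u) dD)).
    rewrite -/(b (D :\ d) (ordval u)) -/(b (D :\ d) (shift (ordval u) [set d])).
    over.
  over.
rewrite exchange_big /=.
have face (d : 'I_M) (a : nat) (D' : {set 'I_M})
    (u : {ffun 'I_M -> 'I_n.+1}) (A : {set 'I_M}) :
    d \notin D' -> A \subset D' -> u d = a :> nat -> shift (ordval u) A d = a.
  move=> dD' AD' <-; rewrite /shift /ordval.
  by rewrite (contraNF (fintype.subsetP AD' d) dD') addn0.
(* Only the end [n] of direction [kk] contributes: [s k] is 0 at its other end, and at both ends of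
   a direction [d < k] the label [s d] is constant, which kills [cup k]. *)
have tel d : d \in D ->
    \sum_(u : {ffun 'I_M -> 'I_n.+1} | [forall i : 'I_M,
      if (i < k.+1)%N then (u i < n)%N else (u i == n :> nat)])
     (b (D :\ d) (ordval u) + b (D :\ d) (shift (ordval u) [set d])) =
       (d == kk)%:R.
  move=> dD; pose q (i : 'I_M) x :=
    if (i < k.+1)%N then (x < n)%N else (x == n).
  rewrite (eq_bigl (fun u : {ffun 'I_M -> 'I_n.+1} => [forall i,
    (i != d) ==> q i (u i)] && (u d < n)%N)); last first.
    move=> u; apply/forallP/andP => [h|[/forallP h ud] i].
      split; first by apply/forallP => i; apply/implyP => _; exact: h.
      by move: (h d); rewrite inE in dD; rewrite dD.
    have := h i; case: (eqVneq i d) => [-> _|_] //=.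
    by rewrite inE in dD; rewrite dD.
  rewrite telescope_F2 //; last exact: bE.
  have dDd : d \notin D :\ d by rewrite !inE eqxx.
  have dk : d != kk -> (d < k)%N.
    by move: dD; rewrite inE ltnS leq_eqVlt -val_eqE /=; case: eqP.
  rewrite [X in X + _]big1 ?add0r; last first.
    move=> u /andP[_ /eqP ud]; rewrite /b.
    case: (eqVneq d kk) => [dkk|/dk lt].
      by rewrite (s_lo (j := kk)) ?mul0r // -dkk (face _ _ _ _ _ dDd _ ud).
    rewrite (cup_eq0 (j := d) (a := 0)) ?mulr0 // => A AD.
    by rewrite s_lo // (face _ _ _ _ _ dDd AD ud).
  case: (eqVneq d kk) => [dkk|/dk lt] /=; last first.
    rewrite big1 // => u /andP[_ /eqP ud]; rewrite /b.
    rewrite (cup_eq0 (j := d) (a := 1)) ?mulr0 // => A AD.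
    by rewrite s_hi // (face _ _ _ _ _ dDd AD ud).
  rewrite -(IH (ltnW kM)).
  have Dd : D :\ d = [set i : 'I_M | (i < k)%N].
    apply/setP => i; rewrite !inE dkk -val_eqE /= ltnS.
    by rewrite [RHS]ltn_neqAle.
  apply: eq_big => [u|u /andP[_ /eqP ud]].
    rewrite dkk; apply/andP/forallP => [[/forallP h /eqP ukk] i|h].
      have := h i; rewrite /q ltnS leq_eqVlt -val_eqE /=;
        case: eqVneq => [ik _|] //=.
      have -> : i = kk by exact/val_inj.
      by rewrite ltnn ukk.
    split; last by have := h kk; rewrite /= ltnn.
    apply/forallP => i; apply/implyP; rewrite -val_eqE /= => ik.
    by have := h i; rewrite /q ltnS [(i <= k)%N]leq_eqVlt (negbTE ik).
  rewrite /b Dd (s_hi (j := kk)) ?mul1r //.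
  by rewrite -Dd -dkk (face _ _ _ _ _ dDd _ ud).
rewrite (eq_bigr _ tel) (bigD1 kk) /=; last by rewrite inE.
by rewrite eqxx big1 ?addr0 // => d /andP[_ /negbTE ->].
Qed.

End Cell.

(* A discrete Poincare-Miranda theorem. *)
Lemma sign_change_cell (M n : nat) (s : 'I_M -> ('I_M -> nat) -> bool) :
  (0 < n)%N ->
  (forall j v, v j = 0%N -> s j v = false) ->
  (forall j v, v j = n -> s j v = true) ->
  (forall j v v', v =1 v' -> s j v = s j v') ->
  exists v : 'I_M -> nat, (forall i, (v i < n)%N) /\
    forall j, exists A B, s j (shift v A) && ~~ s j (shift v B).
Proof.
move=> n0 s0 s1 s_ext.
pose t k v : 'F_2 := if insub k is Some j then (s j v)%:R else 0.
have tE (j : 'I_M) v : t j v = (s j v)%:R by rewrite /t valK.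
have t_ext k v v' : v =1 v' -> t k v = t k v'.
  by move=> e; rewrite /t; case: insub => // j; rewrite (s_ext _ _ _ e).
have := @sum_cup M n t n0 t_ext _ _ M (leqnn M).
have lo (j : 'I_M) v : v j = 0%N -> t j v = 0 by move=> h; rewrite tE s0.
have hi (j : 'I_M) v : v j = n -> t j v = 1 by move=> h; rewrite tE s1.
move=> /(_ lo hi) sum1.
(* A total of 1 leaves a cell with nonzero product. If some [s j] were constant on its vertices,
   [cup_eq0] would give 0. *)
have [u /andP[/forallP un cu]] : exists u : {ffun 'I_M -> 'I_n.+1},
    [forall i : 'I_M, if (i < M)%N then (u i < n)%N else (u i == n :> nat)] &&
    (cup t M (ordval u) [set i : 'I_M | (i < M)%N] != 0).
  apply/existsP; apply: contraT; rewrite negb_exists => /forallP h.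
  move: sum1; rewrite big1 => [/esym/eqP|u uP]; first by rewrite oner_eq0.
  by have := h u; rewrite uP /= negbK => /eqP.
exists (ordval u); split=> [i|j]; first by have := un i; rewrite ltn_ord.
have [[A sA]|nA] := pselect (exists A, s j (shift (ordval u) A)); last first.
  move: cu; rewrite (cup_eq0 (j := j) (a := 0)) ?eqxx // => A _.
  by rewrite tE; case: (boolP (s j _)) => // sA; case: nA; exists A.
have [[B sB]|nB] := pselect (exists B, ~~ s j (shift (ordval u) B)).
  by exists A, B; rewrite sA.
move: cu; rewrite (cup_eq0 (j := j) (a := 1)) ?eqxx // => B _.
by rewrite tE; case: (boolP (s j _)) => // sB; case: nB; exists B.
Qed.

Local Open Scope classical_set_scope.
Local Open Scope ring_scope.

(** * Zeros of vector fields on a cube *)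

Section Zero.
Variables (R : realType) (M : nat).
Implicit Types (f : 'rV[R]_M).

Definition cube f := forall i, `|f 0 i| <= 1.

Lemma cube_cluster (u : nat -> 'rV[R]_M) : (forall n, cube (u n)) ->
  exists f, cube f /\
    forall U k, nbhs f U -> exists n, (k <= n)%N /\ U (u n).
Proof.
move=> uc.
have cK : compact [set f : 'rV[R]_M | forall i, f ord0 i \in `[-1, 1]].
  by apply: (@rV_compact _ _ (fun=> `[(-1 : R), 1]%classic)) => _;
    exact: segment_compact.
have cubeE f : cube f <-> forall i, f 0 i \in `[-1, 1].
  by split => h i; have := h i; rewrite in_itv/= ler_norml.
have [|f [/cubeE fc cl]] := cK (u @ \oo) _.
  by exists 0%N => // n _; exact/cubeE.
exists f; split=> // U k fU.
have [|_ [[n kn <-] Un]] := cl [set u n | n in [set n | (k <= n)%N]] U _ fU.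
  by exists k => // n; exists n.
by exists n.
Qed.

Lemma nbhs_coord f U : nbhs f U -> exists2 e : R, 0 < e &
  forall g : 'rV[R]_M, (forall i, `|g 0 i - f 0 i| < e) -> U g.
Proof.
move=> /nbhs_ballP[e /= e0 eU]; exists e => // g gf; apply: eU.
split=> // j i; rewrite ord1 /ball /= distrC; exact: gf.
Qed.

Lemma coord_neq f j (a : R) : f 0 j != a ->
  nbhs f [set g : 'rV[R]_M | g 0 j != a].
Proof.
move=> fj; have h := @coord_continuous R 1 M 0 j f.
apply: (h [set x : R | x != a]).
by apply: open_nbhs_nbhs; split => //; exact: open_neq.
Qed.

(** Sign-changing cells of finer and finer grids accumulate at a point [f] where every
    [f 0 j * G j f] is at most 0. Positivity on the boundary puts [f] in the interior, where the
    [G j] vanish. *)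
Theorem cube_zero (G : 'I_M -> 'rV[R]_M -> R) :
  (forall m, continuous (G m)) ->
  (forall f, cube f -> (exists i, `|f 0 i| = 1) -> 0 < \sum_i f 0 i * G i f) ->
  exists f, cube f /\ forall i, G i f = 0.
Proof.
move=> Gc Gpos.
pose pt n (w : 'I_M -> nat) : 'rV[R]_M := \row_i ((w i)%:R / n.+1%:R *+ 2 - 1).
(* The labels are forced on the two faces normal to direction [j], so that the discrete theorem
   applies without a sign condition on each [G j] there. *)
pose s n (j : 'I_M) (w : 'I_M -> nat) :=
  if w j == 0%N then false else if w j == n.+1 then true else 0 <= G j (pt n w).
have sc n : exists v : 'I_M -> nat, (forall i, (v i < n.+1)%N) /\
    forall j, exists A B, s n j (shift v A) && ~~ s n j (shift v B).
  apply: sign_change_cell => // j v.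
  - by rewrite /s => ->.
  - by rewrite /s => ->; rewrite eqxx.
  - by move=> v' e; rewrite /s e;
      congr (if _ then _ else if _ then _ else 0 <= G j _);
      apply/rowP => i; rewrite !mxE e.
move/choice: sc => [v sc].
have ptc n w : (forall i, (w i <= n.+1)%N) -> cube (pt n w).
  move=> wn i; rewrite mxE ler_norml.
  have h1 : 0 <= (w i)%:R / n.+1%:R :> R by rewrite divr_ge0.
  have h2 : (w i)%:R / n.+1%:R <= 1 :> R by rewrite ler_pdivrMr ?mul1r ?ler_nat.
  by move: (_ / _) h1 h2 => x h1 h2; apply/andP; split; rewrite mulr2n; lra.
have [|f [fc cl]] := @cube_cluster (fun n => pt n (v n)) _.
  by move=> n; apply: ptc => i; apply: ltnW; exact: (sc n).1.
(* Cells have side [2 / n.+1], which is below [e / 2] once [1 / n.+1 < e / 4]; a whole cell then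
   fits in [U]. *)
have key U : nbhs f U -> exists n, forall A, U (pt n (shift (v n) A)).
  move=> /nbhs_coord[e e0 eU].
  have e40 : 0 < e / 4 by lra.
  have e20 : 0 < e / 2 by lra.
  have [k _ ke] := near_infty_natSinv_lt (PosNum e40).
  have [n [kn [_ pn]]] := cl _ k (nbhsx_ballx f (e / 2) e20).
  exists n => A; apply: eU => i.
  have pni : `|pt n (v n) 0 i - f 0 i| < e / 2.
    by rewrite distrC; exact: (pn 0 i).
  have ne : n.+1%:R^-1 < e / 4 := ke n kn.
  have d : `|pt n (shift (v n) A) 0 i - pt n (v n) 0 i| < e / 2.
    have -> : pt n (shift (v n) A) 0 i - pt n (v n) 0 i =
      (i \in A)%:R * n.+1%:R^-1 *+ 2.
      by rewrite !mxE /shift natrD !mulr2n; ring.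
    rewrite normrMn ger0_norm ?mulr_ge0 // mulr2n.
    have : (i \in A)%:R * n.+1%:R^-1 <= n.+1%:R^-1 :> R.
      by rewrite ler_piMl //; case: (i \in A).
    move: ne; set y := n.+1%:R^-1; move: y => y ne; set x := (_ * y);
      move: x => x h; lra.
  have := ler_normD (pt n (shift (v n) A) 0 i - pt n (v n) 0 i)
                    (pt n (v n) 0 i - f 0 i).
  by rewrite addrA subrK; lra.
(* Near [f], a false label means [G j < 0] unless forced on the face [-1], and a true one means
   [0 <= G j] unless forced on the face [1]. *)
have sgn j : (f 0 j = -1 \/ G j f <= 0) /\ (f 0 j = 1 \/ 0 <= G j f).
  split.
    have [->|fj] := eqVneq (f 0 j) (-1); first by left.
    right; rewrite leNgt; apply/negP => Gj.
    have n1 : nbhs f [set g | 0 < G j g] := Gc j f _ (lt_nbhsr Gj).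
    have [n nU] := key _ (filterI n1 (coord_neq fj)).
    have [_ [B /andP[_]]] := (sc n).2 j.
    have [/ltW GB /= nB] := nU B.
    rewrite /s GB; case: eqVneq => // vj; last by case: ifP.
    by move: nB; rewrite !mxE vj mul0r mul0rn add0r => /eqP.
  have [->|fj] := eqVneq (f 0 j) 1; first by left.
  right; rewrite leNgt; apply/negP => Gj.
  have n1 : nbhs f [set g | G j g < 0] := Gc j f _ (lt_nbhsl Gj).
  have [n nU] := key _ (filterI n1 (coord_neq fj)).
  have [A [_ /andP[+ _]]] := (sc n).2 j.
  have [/= GA /= nA] := nU A.
  rewrite /s; case: eqVneq => // vj0; case: eqVneq => [vj|vj];
    last by rewrite leNgt GA.
  by move: nA; rewrite !mxE vj divff // mulr2n addrK => /eqP.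
have fG j : f 0 j * G j f <= 0 /\ (`|f 0 j| != 1 -> G j f = 0).
  have [[h1|h1] [h2|h2]] := sgn j.
  - suff: False by [].
    by rewrite h1 in h2; lra.
  - by rewrite h1 normrN1 eqxx mulN1r oppr_le0.
  - by rewrite h2 normr1 eqxx mul1r.
  - by have -> : G j f = 0; [apply/eqP; rewrite eq_le h1 h2|rewrite mulr0].
exists f; split=> // j; have [|h] := eqVneq `|f 0 j| 1; last exact: (fG j).2 h.
move=> fj1; have := Gpos f fc (ex_intro _ j fj1); rewrite ltNge => /negP[].
by apply: sumr_le0 => i _; exact: (fG i).1.
Qed.

End Zero.

(** * Points selected by shifted grids *)

(** Clamping the parameter to [[0, 1]] extends the path continuously to the whole line. *)
Lemma path_connected_continuous (R : realType) (X : topologicalType) (x y : X) :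
  path_connected R X ->
  exists gamma : R -> X, [/\ continuous gamma, gamma 0 = x & gamma 1 = y].
Proof.
move=> /(_ x y)[g [gc g0 g1]].
pose clamp (t : R) := Num.max 0 (Num.min 1 t).
have clamp_c : continuous clamp.
  move=> t; apply: (@continuous_max R R (cst 0) (fun t => Num.min 1 t));
    first exact: cvg_cst.
  by apply: (@continuous_min R R (cst 1) id); [exact: cvg_cst|exact: cvg_id].
have clamp01 t : `[0, 1]%classic (clamp t).
  by rewrite /= in_itv /= /clamp le_max lexx /= ge_max ler01 ge_min lexx.
exists (g \o clamp); split.
- move=> t U /= gU.
  have /subspace_continuousP/(_ (clamp t) (clamp01 t) U gU) := gc.
  move=> h.
  have : nbhs t (clamp @^-1` [set s | `[0, 1]%classic s -> U (g s)]) :=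
    clamp_c t _ h.
  by apply: filterS => s /(_ (clamp01 s)).
- by rewrite /= /clamp min_r // maxxx.
- by rewrite /= /clamp minxx max_r.
Qed.

Lemma cvg_sum (R : realType) (T : Type) (F : set_system T)
    (I : Type) (r : seq I) (P : pred I) (h : I -> T -> R) (l : I -> R) :
  Filter F ->
  (forall i, P i -> h i x @[x --> F] --> l i) ->
  \sum_(i <- r | P i) h i x @[x --> F] --> \sum_(i <- r | P i) l i.
Proof.
move=> FF hl; apply: cvg_big hl.
exact: add_continuous.
Qed.

Section Trapezoid.
Variables (R : realType) (rho : R).
Hypothesis rho0 : 0 < rho.

Definition trapezoid (s : R) : R :=
  Num.max 0 (Num.min 1 (Num.min s (1 - s) / rho)).

Lemma trapezoid_continuous : continuous trapezoid.
Proof.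
move=> t; apply: (@continuous_max R R (cst 0) (fun t =>
  Num.min 1 (Num.min t (1 - t) / rho))).
  exact: cvg_cst.
apply: (@continuous_min R R (cst 1) (fun t => Num.min t (1 - t) / rho));
  first exact: cvg_cst.
apply: cvgMr_tmp; apply: (@continuous_min R R id (fun t => 1 - t));
  first exact: cvg_id.
by apply: cvgB; [exact: cvg_cst|exact: cvg_id].
Qed.

Lemma trapezoid_neq0 s : trapezoid s != 0 -> 0 < s < 1.
Proof.
apply: contra_neqT; rewrite negb_and -!leNgt => s01.
apply/max_idPl; rewrite ge_min pmulr_lle0 ?invr_gt0 // ge_min subr_le0.
by rewrite s01 orbT.
Qed.

Lemma trapezoid_eq1 s : rho <= s <= 1 - rho -> trapezoid s = 1.
Proof.
move=> /andP[s1 s2]; rewrite /trapezoid (min_idPl _) ?max_r //.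
by rewrite ler_pdivlMr // mul1r le_min s1; lra.
Qed.

End Trapezoid.

Section Selection.
Variables (R : realType) (X : topologicalType) (M N n : nat).
Variables (b : 'I_M -> X -> R) (x0 : X).
Local Notation cell := {ffun 'I_M -> 'I_(n.*2).+1}.
Variable gamma : cell -> R -> X.
Hypotheses (N0 : (0 < N)%N) (n0 : (0 < n)%N).
Hypothesis b_cont : forall m, continuous (b m).
Hypothesis gamma_cont : forall v, continuous (gamma v).
Hypothesis gamma0 : forall v, gamma v 0 = x0.
Implicit Types (f : 'rV[R]_M) (v : cell) (i : 'I_N) (m : 'I_M).

Definition rho : R := (4 * N)%:R^-1.
(** The offsets [(i + 1/2) / N] of the grids, spaced by [1 / N = 4 * rho]. *)
Definition theta i : R := (2 * i + 1)%:R / (2 * N)%:R.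
(** Coordinates in which cells have side 1 and the cube is [[0, 2n]^M]. *)
Definition scaled f m : R := n%:R * (f 0 m + 1).
(* Equal to 1 well inside the cell [v] of the i-th grid, to 0 outside it. *)
Definition bump f i v : R :=
  \prod_m trapezoid rho (scaled f m + theta i - (v m)%:R).
(* [b m] at the point [gamma v (bump f i v)], where [v] is the only cell with
   nonzero bump, if any, and at [x0] otherwise: see [selectP].  As a sum over
   all cells this is visibly continuous in [f]. *)
Definition select i m f : R :=
  b m x0 + \sum_v (b m (gamma v (bump f i v)) - b m x0).
(** Independent of the grid: it is within [1 / n] of every point well inside the cell [v] of any of
    the grids, so that one almost maximiser per [v] serves them all. *)
Definition corner v : 'rV[R]_M := \row_m ((v m)%:R / n%:R - 1).

Let NR0 : 0 < N%:R :> R. Proof. by rewrite ltr0n. Qed.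
Let nR0 : 0 < n%:R :> R. Proof. by rewrite ltr0n. Qed.

Lemma rho_gt0 : 0 < rho.
Proof. by rewrite invr_gt0 ltr0n muln_gt0. Qed.

Lemma rhoE : rho * N%:R = 1 / 4.
Proof. by rewrite /rho natrM invfM -mulrA mulVf ?mulr1 ?mul1r // gt_eqF. Qed.

Lemma thetaE i : theta i = rho * (4 * i + 2)%:R.
Proof.
rewrite /theta /rho natrD (natrD _ (4 * i)%N) !(natrM _ 2) !(natrM _ 4); field.
by rewrite gt_eqF.
Qed.

Lemma theta_itv i : rho <= theta i <= 1 - rho.
Proof.
rewrite thetaE; have := rho_gt0 => r0; apply/andP; split.
  by rewrite ler_pMr // ler1n addn2.
have h : (4 * i + 2)%:R + 1 <= (4 * N)%:R :> R.
  by rewrite natr1 ler_nat; have := ltn_ord i; lia.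
have e : rho * (4 * N)%:R = 1.
  by rewrite /rho mulVf // pnatr_eq0 muln_eq0 -lt0n N0.
by have := ler_wpM2l (ltW r0) h; rewrite e mulrDr mulr1; lra.
Qed.

Lemma select_continuous i m : continuous (select i m).
Proof.
(* Over an abstract space, since filter inference is fragile on matrices. *)
have abstract (T : topologicalType) (g : 'I_M -> T -> R) :
  (forall j, continuous (g j)) ->
  continuous (fun t => b m x0 + \sum_v (b m (gamma v
    (\prod_j trapezoid rho (n%:R * (g j t + 1) + theta i - (v j)%:R)))
      - b m x0)).
  move=> gc t; apply: cvgD; first exact: cvg_cst.
  apply: cvg_sum => v _; apply: cvgB; last exact: cvg_cst.
  apply: (@continuous_cvg T R R _ _ _ (fun s => b m (gamma v s))).
    by apply: continuous_comp; [exact: gamma_cont|exact: b_cont].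
  apply: (cvg_big (@mul_continuous R)) => j _.
  apply: (@continuous_cvg T R R _ _ _ (trapezoid rho));
    first exact: trapezoid_continuous.
  apply: cvgB; last exact: cvg_cst.
  apply: cvgD; last exact: cvg_cst.
  by apply: cvgMl_tmp; apply: cvgD; [exact: gc|exact: cvg_cst].
apply: (abstract _ (fun j (f : 'rV[R]_M) => f 0 j)) => j.
exact: coord_continuous.
Qed.

Lemma bump_uniq f i v v' : bump f i v != 0 -> bump f i v' != 0 -> v = v'.
Proof.
move=> /prodf_neq0 h /prodf_neq0 h'; apply/ffunP => m; apply/val_inj => /=.
have /andP[a1 a2] := trapezoid_neq0 rho_gt0 (h m isT).
have /andP[a3 a4] := trapezoid_neq0 rho_gt0 (h' m isT).
have l1 : (v m)%:R < (v' m)%:R + 1 :> R by lra.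
have l2 : (v' m)%:R < (v m)%:R + 1 :> R by lra.
by apply/eqP; rewrite eqn_leq -ltnS -[in X in _ && X]ltnS -!(ltr_nat R)
  -!natr1 l1 l2.
Qed.

Lemma selectP f i : exists p, (forall m, select i m f = b m p) /\
  forall v, bump f i v = 1 -> p = gamma v 1.
Proof.
have [[v hv]|nv] := pselect (exists v, bump f i v != 0).
  exists (gamma v (bump f i v)); split=> [m|v' hv'].
    rewrite /select (bigD1 v) //= big1 ?addr0 1?addrC ?subrK // => v' v'v.
    have [->|/(bump_uniq hv)] := eqVneq (bump f i v') 0;
      first by rewrite gamma0 subrr.
    by move=> vv'; rewrite vv' eqxx in v'v.
  have -> : v = v' by apply: bump_uniq hv _; rewrite hv' oner_neq0.
  by rewrite hv'.
exists x0; split=> [m|v hv].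
  rewrite /select big1 ?addr0 // => v _.
  have [->|h] := eqVneq (bump f i v) 0; first by rewrite gamma0 subrr.
  by case: nv; exists v.
by case: nv; exists v; rewrite hv oner_neq0.
Qed.

Definition good f i v := bump f i v = 1 /\
  forall m, `|f 0 m - corner v 0 m| <= n%:R^-1.

Lemma corner_cube v : cube (corner v).
Proof.
move=> m; rewrite mxE ler_norml.
have h1 : 0 <= (v m)%:R / n%:R :> R by rewrite divr_ge0.
have h2 : (v m)%:R / n%:R <= 2 :> R.
  by rewrite ler_pdivrMr // -natrM ler_nat mul2n -ltnS ltn_ord.
by move: (_ / _) h1 h2 => x h1 h2; apply/andP; split; lra.
Qed.

Definition coord_good f i m := exists k : 'I_(n.*2).+1,
  rho <= scaled f m + theta i - k%:R <= 1 - rho.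

(* The walls of the grids i and i' normal to the m-th direction are at distance
   at least 1 / N > 2 * rho. *)
Lemma coord_bad_uniq f m i i' : cube f ->
  ~ coord_good f i m -> ~ coord_good f i' m -> i = i'.
Proof.
move=> fc.
have r0 := rho_gt0.
have : 0 <= scaled f m <= n.*2%:R.
  rewrite /scaled; have := fc m; rewrite ler_norml => /andP[f1 f2].
  have f0 : 0 <= f 0 m + 1 by lra.
  rewrite mulr_ge0 //=.
  by rewrite -muln2 natrM ler_pM2l //; lra.
rewrite /coord_good; move: (scaled f m) => y /andP[y0 yn].
(* A bad coordinate is within [rho] of a wall, that is, of an integer [c] after the shift by
   [theta j]. *)
have near_nat j : ~ (exists k : 'I_(n.*2).+1,
  rho <= y + theta j - k%:R <= 1 - rho) ->
    exists c : nat, `|y + theta j - c%:R| < rho.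
  move=> bad; have /andP[t1 t2] := theta_itv j.
  have yt0 : 0 <= y + theta j by lra.
  have /andP[k1 k2] := truncn_itv yt0; set k := Num.trunc _ in k1 k2.
  have kn : (k < n.*2.+1)%N.
    by rewrite -(ltr_nat R); apply: le_lt_trans k1 _; rewrite -natr1; lra.
  have [s1|s1] := ltP (y + theta j - k%:R) rho.
    by exists k; rewrite ger0_norm // subr_ge0.
  exists k.+1; rewrite ler0_norm; last by rewrite subr_le0 ltW.
  rewrite opprB ltNge; apply/negP => s2; apply: bad; exists (Ordinal kn) => /=.
  by rewrite s1 /=; move: s2; rewrite -natr1; lra.
move=> /near_nat[c hc] /near_nat[c' hc'].
have even (p q : nat) : `|p%:R - q%:R| < 1 / 2 :> R -> p = q.
  move=> /ltr_normlP[pq qp].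
  have l1 : p%:R < q%:R + 1 :> R by lra.
  have l2 : q%:R < p%:R + 1 :> R by lra.
  by apply/eqP; rewrite eqn_leq -ltnS -[in X in _ && X]ltnS -!(ltr_nat R)
    -!natr1 l1 l2.
(* The two shifted coordinates differ from integers by less than [rho]; multiplied by [N], this puts
   the two sides at distance below [2 * rho * N = 1 / 2]. Reducing mod [N] then identifies [i] and
   [i']. *)
have e : (i + N * c' = i' + N * c)%N.
  apply: even; rewrite (natrD _ i) (natrD _ i') !(natrM _ N).
  have thetaN j : theta j * N%:R = j%:R + 1 / 2.
    rewrite /theta natrD !(natrM _ 2); field.
    by rewrite gt_eqF.
  have -> : i%:R + N%:R * c'%:R - (i'%:R + N%:R * c%:R) =
      N%:R * ((y + theta i - c%:R) - (y + theta i' - c'%:R)) :> R.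
    have -> : i%:R = theta i * N%:R - 1 / 2 by rewrite thetaN addrK.
    have -> : i'%:R = theta i' * N%:R - 1 / 2 by rewrite thetaN addrK.
    by ring.
  rewrite normrM (ger0_norm (ltW NR0)).
  have -> : 1 / 2 = N%:R * (rho + rho)
    by rewrite mulrDr ![N%:R * _]mulrC rhoE; field.
  by rewrite ltr_pM2l // (le_lt_trans (ler_normB _ _)) // ltrD.
have := congr1 (modn^~ N) e;
  rewrite ![(_ + N * _)%N]addnC ![(N * _)%N]mulnC !modnMDl !modn_small //.
by move/val_inj.
Qed.

(** By [coord_bad_uniq], each direction other than [m0] spoils at most one grid. Direction [m0]
    spoils none: there [scaled] is 0 or [2n], and [theta] stays [rho] away from the integers. *)
Lemma good_exists f m0 : cube f -> `|f 0 m0| = 1 ->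
  exists A : {set 'I_N}, (#|A| < M)%N /\
    forall i, i \notin A -> exists v, good f i v.
Proof.
move=> fc fm0.
pose A : {set 'I_N} :=
  finset (fun i => `[< exists2 m, m != m0 & ~ coord_good f i m >]).
exists A; split.
  have M0 : (0 < M)%N by apply: leq_ltn_trans (ltn_ord m0).
  rewrite -(prednK M0) ltnS.
  have -> : M.-1 = #|predC1 m0| by rewrite cardC1 card_ord.
  (* A bad direction for each [i] in [A]; this map is injective and avoids [m0]. *)
  pose c i := xget m0 [set m | m != m0 /\ ~ coord_good f i m].
  have cP i : i \in A ->
      c i != m0 /\ ~ coord_good f i (c i).
    rewrite inE => /asboolP[m mm0 bad]; rewrite /c; case: xgetP => [x -> //|].
    by move=> /(_ m) /= []; split.
  rewrite -(card_in_imset (f := c)).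
    by apply/subset_leq_card/fintype.subsetP => _ /imsetP[i /cP[ci _] ->];
      rewrite !inE.
  move=> i i' /cP[_ h] /cP[_ h'] e; apply: coord_bad_uniq fc h _.
  by rewrite e.
move=> i; rewrite inE => /asboolP iA.
have [t1 t2] := andP (theta_itv i).
have r0 := rho_gt0.
have /choice[v vP] : forall m, exists k : 'I_(n.*2).+1,
    rho <= scaled f m + theta i - k%:R <= 1 - rho.
  move=> m; have [->|mm0] := eqVneq m m0; last first.
    have [[k hk]|h] := pselect (coord_good f i m).
      by exists k.
    by exfalso; apply: iA; exists m.
  have [fp|fn] := leP 0 (f 0 m0).
    have fE : f 0 m0 = 1 by rewrite -fm0 ger0_norm.
    have e : scaled f m0 + theta i - (n.*2)%:R = theta i.
      by rewrite /scaled fE -muln2 natrM; ring.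
    by exists ord_max; rewrite /= e t1 t2.
  have fE : f 0 m0 = -1 by apply/oppr_inj; rewrite opprK -fm0 ltr0_norm.
  by exists ord0; rewrite subr0 /scaled fE addNr mulr0 add0r t1.
have vE : forall m, [ffun m => v m] m = v m by move=> m; rewrite ffunE.
exists [ffun m => v m]; split.
- by rewrite /bump big1 // => m _; rewrite trapezoid_eq1 // ?rho_gt0 // vE;
    exact: vP.
- move=> m; rewrite mxE vE.
  have /andP[s1 s2] := vP m.
  have -> : f 0 m - ((v m)%:R / n%:R - 1) = n%:R^-1 * (scaled f m - (v m)%:R).
    by rewrite /scaled; field; rewrite gt_eqF.
  rewrite normrM gtr0_norm ?invr_gt0 // ler_piMr ?invr_ge0 ?ler0n //.
  by rewrite ler_norml; apply/andP; split; lra.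
Qed.

End Selection.

(** * Zero sums from the selected points *)

Section ZeroSum.
Variables (R : realType) (X : topologicalType) (M : nat).
Variable b : 'I_M -> X -> R.
Implicit Types f g : 'rV[R]_M.

Definition comb f x : R := \sum_m f 0 m * b m x.

Definition cube_boundary f := cube f /\ exists m, `|f 0 m| = 1.

Lemma comb_lipschitz B f g e : (forall m x, `|b m x| <= B) ->
  (forall m, `|f 0 m - g 0 m| <= e) ->
  forall x, comb f x <= comb g x + M%:R * (e * B).
Proof.
move=> bB fg x; rewrite -lerBlDl /comb -sumrB.
apply: le_trans (_ : \sum_(m < M) e * B <= _); last first.
  by rewrite sumr_const card_ord mulr_natl.
apply: ler_sum => m _; rewrite -mulrBl (le_trans (ler_norm _)) // normrM.
by apply: ler_pM.
Qed.

Lemma near_max (x0 : X) B (h : X -> R) d : 0 < d -> (forall x, h x <= B) ->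
  exists q, forall x, h x <= h q + d.
Proof.
move=> d0 hB.
have sh : has_sup (range h).
  by split; [exists (h x0), x0|exists B => _ [x _ <-]].
have [_ [q _ <-] hq] := sup_adherent d0 sh.
exists q => x; have : h x <= sup (range h) by apply: (ub_le_sup sh.2); exists x.
by move: hq; lra.
Qed.

Theorem path_zero_sum (N : nat) (x0 : X) (B s0 kappa : R) :
  path_connected R X ->
  (forall m, continuous (b m)) -> (forall m x, `|b m x| <= B) ->
  0 < s0 -> 0 <= kappa -> (0 < M)%N ->
  (forall f, cube_boundary f -> exists x, s0 <= comb f x) ->
  (forall f, cube_boundary f -> forall S, (forall x, comb f x <= S) ->
     forall x, - (kappa * S) <= comb f x) ->
  M.-1%:R * (1 + kappa) < N%:R ->
  exists p : 'I_N -> X, forall m, \sum_i b m (p i) = 0.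
Proof.
move=> pc bc bB s00 k0 M0 hs hk hN.
have N0 : (0 < N)%N.
  by rewrite -(ltr_nat R) (le_lt_trans _ hN) // mulr_ge0 // addr_ge0.
have B0 : 0 <= B by apply: le_trans (bB (Ordinal M0) x0).
pose Delta := N%:R - M.-1%:R * (1 + kappa).
have D0 : 0 < Delta by rewrite subr_gt0.
(* The loss allowed per point: [N] such losses stay below the surplus [Delta * s0]. *)
pose e := Delta * s0 / N.+1%:R.
have e0 : 0 < e by rewrite divr_gt0 ?mulr_gt0.
have Ne : N%:R * e < Delta * s0.
  rewrite /e mulrA ltr_pdivrMr // mulrC ltr_pM2l ?mulr_gt0 //.
  by rewrite ltr_nat.
have e40 : 0 < e / 4 by rewrite divr_gt0.
(* Fine enough for [comb] to change by at most [e / 4] between a point of the cube and the corner of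
   its cell. *)
pose n := (Num.trunc (M%:R * B / (e / 4))).+1.
have n0 : (0 < n)%N by [].
have nR0 : 0 < n%:R :> R by rewrite ltr0n.
have nP : M%:R * (n%:R^-1 * B) <= e / 4.
  rewrite mulrCA mulrC ler_pdivrMr // -ler_pdivrMl // mulrC ltW //.
  by case/andP: (truncn_itv (divr_ge0 (mulr_ge0 (ler0n R M) B0) (ltW e40))).
have combB f : cube f -> forall x, comb f x <= M%:R * B.
  move=> fc x; apply: le_trans (_ : \sum_(m < M) B <= _); last first.
    by rewrite sumr_const card_ord mulr_natl.
  apply: ler_sum => m _; rewrite (le_trans (ler_norm _)) // normrM.
  by rewrite -[B]mul1r ler_pM.
have maxP f : cube f -> exists q, forall x, comb f x <= comb f q + e / 4.
  by move=> fc; apply: near_max x0 _ _ _ e40 (combB f fc).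
have /choice[q qP] : forall v : {ffun 'I_M -> 'I_(n.*2).+1}, exists q, forall x,
    comb (corner R v) x <= comb (corner R v) q + e / 4.
  by move=> v; apply: maxP; exact: corner_cube.
have /choice[g gP] : forall v, exists g : R -> X,
    [/\ continuous g, g 0 = x0 & g 1 = q v].
  by move=> v; exact: path_connected_continuous.
have gc v : continuous (g v) by have [] := gP v.
have g0 v : g v 0 = x0 by have [] := gP v.
have g1 v : g v 1 = q v by have [] := gP v.
have /choice[P PP] : forall fi : 'rV[R]_M * 'I_N, exists p,
    (forall m, select b x0 g fi.2 m fi.1 = b m p) /\
    forall v, bump fi.1 fi.2 v = 1 -> p = g v 1.
  by move=> [f i]; exact: selectP.
pose G m (f : 'rV[R]_M) := \sum_(i < N) select b x0 g i m f.
have Gc m : continuous (G m).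
  rewrite /G; apply: continuous_big => [|i _]; first exact: add_continuous.
  by move=> f; apply: (select_continuous bc gc).
have Gpos f : cube f -> (exists m, `|f 0 m| = 1) -> 0 < \sum_m f 0 m * G m f.
  move=> fc fb.
  have [m0 fm0] := fb.
  rewrite (_ : \sum_m _ = \sum_i comb f (P (f, i))); last first.
    rewrite /comb [RHS]exchange_big /=; apply: eq_bigr => m _.
    by rewrite /G mulr_sumr; apply: eq_bigr => i _; rewrite ((PP (f, i)).1 m).
  have [z zP] := maxP f fc.
  pose S := comb f z + e / 4.
  have Ss : s0 <= S.
    by have [x] := hs f (conj fc fb); move/le_trans; apply; exact: zP.
  have S0 : 0 < S by apply: lt_le_trans Ss.
  have [A [AM Agood]] := @good_exists R M N n N0 n0 f m0 fc fm0.
  (* Outside [A] the selected point is [q v]. Four losses of [e / 4] occur: two near maximisations,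
     at [f] and at the corner, and two passages between [f] and the corner. *)
  have low i : (if i \in A then - (kappa * S) else S - e) <= comb f (P (f, i)).
    case: ifPn => iA; first exact: hk.
    have [v [v1 fv]] := Agood i iA.
    rewrite ((PP (f, i)).2 v v1) g1.
    have l1 := comb_lipschitz bB fv z.
    have l2 : comb (corner R v) z <= comb f z + M%:R * (n%:R^-1 * B).
      by apply: (comb_lipschitz bB) => m; rewrite distrC.
    have l3 := comb_lipschitz bB fv (q v).
    have l4 : comb (corner R v) (q v) <= comb f (q v) + M%:R * (n%:R^-1 * B).
      by apply: (comb_lipschitz bB) => m; rewrite distrC.
    by have := qP v z; rewrite /S; lra.
  apply: lt_le_trans (ler_sum _ (fun i _ => low i)).
  have -> : \sum_i (if i \in A then - (kappa * S) else S - e) =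
      N%:R * (S - e) - #|A|%:R * ((1 + kappa) * S - e).
    rewrite (eq_bigr (fun i : 'I_N =>
      (S - e) - (if i \in A then (1 + kappa) * S - e else 0))); last first.
      by move=> i _; case: ifP => _; ring.
    rewrite sumrB sumr_const card_ord -big_mkcond sumr_const.
    by rewrite !mulr_natl.
  have A1 : #|A|%:R <= M.-1%:R :> R by rewrite ler_nat -ltnS prednK.
  (* Up to the nonnegative terms [h1], [h2] and [h3], the bound is [Delta * s0 - N * e > 0]. *)
  have h1 : 0 <= (M.-1%:R - #|A|%:R) * ((1 + kappa) * S).
    have S0' := ltW S0.
    rewrite mulr_ge0 ?subr_ge0 //.
    by apply: mulr_ge0 => //; apply: addr_ge0.
  have h2 : 0 <= #|A|%:R * e by apply: mulr_ge0 => //; exact: ltW.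
  have h3 : 0 <= Delta * (S - s0).
    by apply: mulr_ge0; rewrite ?subr_ge0 //; exact: ltW.
  by rewrite /Delta in Ne h3 *; nra.
have [f [fc f0]] := cube_zero Gc Gpos.
exists (fun i => P (f, i)) => m; apply: etrans (f0 m); rewrite /G.
by apply: eq_bigr => i _; rewrite ((PP (f, i)).1 m).
Qed.

End ZeroSum.

(** * Fenchel's theorem for path-connected sets *)

Section Fenchel.
Variables (R : realType) (X : topologicalType) (M : nat).
Variable b : 'I_M -> X -> R.

(** The weights of a convex combination equal to 0, left unnormalised so that they can be changed
    one at a time. *)
Definition balanced k (z : 'I_k -> X) (l : 'I_k -> R) :=
  [/\ forall i, 0 <= l i, 0 < \sum_i l i &
      forall m, \sum_i l i * b m (z i) = 0].

Definition balanceable k := exists z : 'I_k -> X, exists l, balanced z l.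

Lemma balanced_drop k (z : 'I_k.+1 -> X) l i :
  balanced z l -> l i = 0 -> balanceable k.
Proof.
move=> [l0 ls lb] li; exists (z \o lift i), (l \o lift i); split => [j||m] /=.
- exact: l0.
- by move: ls; rewrite (bigD1_ord i) //= li add0r.
- by have := lb m; rewrite (bigD1_ord i) //= li mul0r add0r.
Qed.

(** An exchange: [x] enters while a point of weight zero leaves, which keeps the number of points at
    [k]. *)
Lemma balanced_cons k (x : X) (z : 'I_k -> X) (l0 : R) (l : 'I_k -> R) :
  0 < l0 -> (forall i, 0 <= l i) ->
  (forall m, l0 * b m x + \sum_i l i * b m (z i) = 0) ->
  (exists i, l i = 0) -> balanceable k.
Proof.
move=> l00 lp lb [i li].
pose cons T (x0 : T) (h : 'I_k -> T) j :=
  if unlift ord0 j is Some j' then h j' else x0.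
have cons0 T (x0 : T) h : cons T x0 h ord0 = x0 by rewrite /cons unlift_none.
have consS T (x0 : T) h j : cons T x0 h (lift ord0 j) = h j.
  by rewrite /cons liftK.
apply: (@balanced_drop _ (cons X x z) (cons R l0 l) (lift ord0 i));
  last by rewrite consS.
split=> [j||m].
- by rewrite /cons; case: unliftP => [j' _|_]; [exact: lp|exact: ltW].
- rewrite big_ord_recl cons0 ltr_wpDr //; apply: sumr_ge0 => j _.
  by rewrite consS.
- rewrite big_ord_recl !cons0 -[RHS](lb m); congr (_ + _).
  by apply: eq_bigr => j _; rewrite !consS.
Qed.

(** A linear relation between the last [k] values is subtracted from the weights until one of them
    vanishes. The weight of the first point is untouched, so the total stays positive. *)
Lemma caratheodory_step k (z : 'I_k.+1 -> X) l : balanced z l ->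
  ~~ row_free (\matrix_(i < k, m < M) b m (z (lift ord0 i))) -> balanceable k.
Proof.
move=> bzl; have [l0 ls lb] := bzl.
have [[i li]|lpos] := pselect (exists i, l i = 0).
  by move=> _; exact: balanced_drop bzl li.
have {}lpos i : 0 < l i.
  by rewrite lt_def l0 andbT; apply/eqP => li; apply: lpos; exists i.
rewrite -kermx_eq0 => /rowV0Pn[c /sub_kermxP cA c0].
wlog [j0 cj0] : c cA c0 / exists j, 0 < c 0 j.
  move=> W; have /rV0Pn[j cj] := c0.
  have [cp|cn] := ltP 0 (c 0 j); first by apply: (W c) => //; exists j.
  apply: (W (- c)); first by rewrite mulNmx cA oppr0.
    by rewrite oppr_eq0.
  by exists j; rewrite mxE oppr_gt0 lt_neqAle cj.
pose r j := l (lift ord0 j) / c 0 j.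
(* The smallest ratio is the largest multiple of the relation that keeps all weights nonnegative. *)
case: (@arg_minP _ R _ j0 (fun j => 0 < c 0 j) r cj0) => j cj jmin.
apply: (@balanced_cons k (z ord0) (z \o lift ord0) (l ord0)
  (fun i => l (lift ord0 i) - r j * c 0 i)) => //.
- move=> i; rewrite subr_ge0; have [ci|ci] := ltP 0 (c 0 i).
    by rewrite -ler_pdivlMr //; exact: jmin.
  apply: le_trans (ltW (lpos _)); apply: mulr_ge0_le0 => //.
  by rewrite divr_ge0 // ltW.
- move=> m; rewrite /=; under eq_bigr do rewrite mulrBl -mulrA.
  rewrite sumrB -mulr_sumr addrA -[in RHS](lb m) [in RHS]big_ord_recl.
  have /rowP/(_ m) := cA; rewrite !mxE => cAm.
  by rewrite [X in r j * X](_ : _ = 0) ?mulr0 ?subr0 // -[RHS]cAm;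
    apply: eq_bigr => i _; rewrite mxE.
- by exists j; rewrite /r divfK ?subrr // gt_eqF.
Qed.

(** If the last [k] values are independent, then [k = M] and they form a basis. Moving the first
    point along a path to one of the others makes some weight vanish on the way. *)
Lemma fenchel_step k (z : 'I_k.+1 -> X) l : path_connected R X ->
  (forall m, continuous (b m)) -> (0 < M)%N -> (M <= k)%N ->
  balanced z l -> balanceable k.
Proof.
move=> pc bc M0 Mk bzl; have [l0 ls lb] := bzl.
have [[i li]|lpos] := pselect (exists i, l i = 0);
  first exact: balanced_drop bzl li.
have {}lpos i : 0 < l i.
  by rewrite lt_def l0 andbT; apply/eqP => li; apply: lpos; exists i.
have [free|] := boolP (row_free
    (\matrix_(i < k, m < M) b m (z (lift ord0 i)))); last first.
  exact: caratheodory_step bzl.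
have kM : k = M.
  by apply/eqP; rewrite eqn_leq Mk andbT -(eqP free) rank_leq_col.
move: z l bzl free l0 ls lb lpos;
  rewrite {}kM => {Mk k} z l bzl free l0 ls lb lpos.
set A := (\matrix_(i, m) _) in free.
have Au : A \in unitmx by rewrite -row_free_unit.
pose j0 : 'I_M := Ordinal M0.
have [g [gc g0 g1]] := path_connected_continuous (z ord0) (z (lift ord0 j0)) pc.
(* The coordinates of minus the value at [g t] in the basis given by the rows of [A]: all positive
   at time 0, and minus a basis vector at time 1. *)
pose a t : 'rV[R]_M := - ((\row_m b m (g t)) *m invmx A).
have aA t m : b m (g t) + \sum_i a t 0 i * b m (z (lift ord0 i)) = 0.
  have /rowP/(_ m) : a t *m A = - \row_m b m (g t) by rewrite mulNmx mulmxKV.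
  rewrite [RHS]mxE [in RHS]mxE => H; apply/eqP; rewrite addrC addr_eq0 -H mxE.
  by apply/eqP/eq_bigr => i _; rewrite [A _ _]mxE.
have a_uniq t (c : 'rV[R]_M) : c *m A = - \row_m b m (g t) -> a t = c.
  by move=> cA; rewrite /a -mulNmx -cA mulmxK.
have a_cont j : continuous (fun t => a t 0 j).
  move=> t; rewrite /continuous_at.
  have aE s : a s 0 j = \sum_m - b m (g s) * invmx A m j.
    by rewrite /a !mxE -sumrN; apply: eq_bigr => m _; rewrite mxE mulNr.
  rewrite aE; under eq_fun do rewrite aE.
  apply: cvg_sum => m _; apply: cvgMr_tmp; apply: cvgN.
  by apply: continuous_comp; [exact: gc|exact: bc].
(* The default 1 only caps the minimum from above and does not affect its sign. *)
pose h t := \big[Num.min/1]_j a t 0 j.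
have hc : continuous h.
  apply: continuous_big => [|j _]; last exact: a_cont.
  move=> [x y]; apply: (@continuous_min R (R * R)%type (@fst R R) (@snd R R));
    [exact: cvg_fst|exact: cvg_snd].
have h0 : 0 < h 0.
  apply/bigmin_gtP; split=> // j _.
  have -> : a 0 = \row_j (l (lift ord0 j) / l ord0).
    apply: a_uniq; apply/rowP => m; rewrite !mxE g0.
    apply: (@mulfI _ (l ord0)); first by rewrite gt_eqF.
    have := lb m; rewrite big_ord_recl => /eqP; rewrite addrC addr_eq0 => /eqP.
    rewrite mulrN => <-; rewrite mulr_sumr; apply: eq_bigr => i _.
    rewrite !mxE mulrA; congr (_ * _); rewrite mulrC divfK // gt_eqF //.
  by rewrite mxE divr_gt0.
have h1 : h 1 < 0.
  have -> : h 1 = \big[Num.min/1]_j (- delta_mx 0 j0 : 'rV[R]_M) 0 j.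
    apply: eq_bigr => j _; congr (fun_of_matrix _ 0 j).
    by apply: a_uniq; rewrite mulNmx -rowE; congr (- _); apply/rowP => m;
      rewrite !mxE g1.
  apply/bigmin_ltP; right; exists j0 => //.
  by rewrite !mxE !eqxx oppr_lt0.
have [||c _ hc0] := @IVT R h 0 1 0 ler01 _ _.
- exact: continuous_subspaceT.
- by rewrite ge_min le_max (ltW h0) (ltW h1) orbT.
have ac j : 0 <= a c 0 j by rewrite -hc0; exact: bigmin_le.
apply: (@balanced_cons M (g c) (z \o lift ord0) 1 (a c 0)) => // [m|].
  by rewrite mul1r; exact: aA.
have /bigmin_leP[|[j _ aj]] : h c <= 0 by rewrite hc0.
  by rewrite ler10.
by exists j; apply/eqP; rewrite eq_le aj ac.
Qed.

Theorem fenchel k : path_connected R X -> (forall m, continuous (b m)) ->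
  (0 < M)%N -> balanceable k -> exists2 k', (k' <= M)%N & balanceable k'.
Proof.
move=> pc bc M0 bk.
have ex : exists k, `[< balanceable k >] by exists k; apply/asboolP.
case: (ex_minnP ex) => k' /asboolP bk' kmin.
exists k' => //; rewrite leqNgt; apply/negP => Mk'.
case: k' Mk' bk' kmin => // k' Mk' [z [l bzl]] kmin.
have /asboolP/kmin := fenchel_step pc bc M0 Mk' bzl.
by rewrite ltnn.
Qed.

End Fenchel.

(** * Bounded continuous functions *)

Section BoundedContinuous.
Variables (R : realType) (X : ptopologicalType) (mu : probability (borel X) R).

Definition bcf (f : X -> R) := continuous f /\ exists B, forall x, `|f x| <= B.

Lemma open_measurable_borel (U : set X) : open U ->
  measurable (U : set (borel X)).
Proof. by move=> oU; apply: sub_sigma_algebra. Qed.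

Lemma continuous_measurable_borel (f : X -> R) : continuous f ->
  measurable_fun [set: borel X] (f : borel X -> R).
Proof.
move=> /continuousP fc; apply: (measurability _ (RGenOpens.measurableE R)).
move=> _ [_ [a [c ->] <-]]; rewrite setTI; apply: open_measurable_borel.
exact/fc/interval_open.
Qed.

Lemma continuous_measurable_map (phi : X -> X) : continuous phi ->
  measurable_fun [set: borel X] (phi : borel X -> borel X).
Proof.
move=> /continuousP pc; apply: (@measurability _ _ (borel X) (borel X)
  setT phi (@open X)) => //.
by move=> _ [U oU <-]; rewrite setTI; apply: open_measurable_borel; exact: pc.
Qed.

Lemma bcf_integrable f : bcf f ->
  mu.-integrable setT (EFin \o (f : borel X -> R)).
Proof.
move=> [fc [B fB]]; apply: measurable_bounded_integrable => //.
- by rewrite (le_lt_trans (probability_le1 _ _)) ?ltry.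
- exact: continuous_measurable_borel.
- exists B; split; first exact: num_real.
  by move=> C BC x _; exact: le_trans (fB x) (ltW BC).
Qed.

Lemma bcfD f g : bcf f -> bcf g -> bcf (fun x => f x + g x).
Proof.
move=> [fc [B fB]] [gc [C gC]]; split.
  by move=> x; apply: cvgD; [exact: fc|exact: gc].
by exists (B + C) => x; rewrite (le_trans (ler_normD _ _)) // lerD.
Qed.

Lemma bcfZ (a : R) f : bcf f -> bcf (fun x => a * f x).
Proof.
move=> [fc [B fB]]; split; first by move=> x; apply: cvgMl_tmp; exact: fc.
by exists (`|a| * B) => x; rewrite normrM ler_wpM2l.
Qed.

Lemma bcf_cst (a : R) : bcf (fun=> a).
Proof. by split; [move=> x; exact: cvg_cst|exists `|a|]. Qed.

Lemma bcf_sum n (f : 'I_n -> X -> R) : (forall i, bcf (f i)) ->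
  bcf (fun x => \sum_i f i x).
Proof.
move=> fb; split; first by move=> x; apply: cvg_sum => i _; exact: (fb i).1.
have /choice[B BP] := fun i => (fb i).2.
exists (\sum_i B i) => x.
by rewrite (le_trans (ler_norm_sum _ _ _)) // ler_sum.
Qed.

Lemma bcf_norm f : bcf f -> bcf (fun x => `|f x|).
Proof.
move=> [fc [B fB]]; split; last by exists B => x; rewrite normr_id.
by move=> x; apply: cvg_norm; exact: fc.
Qed.

Lemma bcf_comp f (phi : X -> X) : continuous phi -> bcf f -> bcf (f \o phi).
Proof.
move=> pc [fc [B fB]]; split; last by exists B => x; exact: fB.
by move=> x; apply: continuous_comp; [exact: pc|exact: fc].
Qed.

Lemma Rintegral_preserved f (phi : X -> X) : continuous phi ->
  measure_preserving mu phi -> bcf f ->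
  \int[mu]_x (f (phi x)) = \int[mu]_x f x.
Proof.
move=> pc mp fb; rewrite /Rintegral; congr fine.
have mphi := continuous_measurable_map pc.
have mf : measurable_fun [set: borel X] (EFin \o (f : borel X -> R)).
  by apply/measurable_EFinP; apply: continuous_measurable_borel fb.1.
have := @integral_pushforward _ _ _ _ R
  (phi : borel X -> borel X) mphi mu setT _ mf.
rewrite preimage_setT => /(_ _ measurableT) => <-.
  by apply: eq_measure_integral => A mA _; exact: mp.
exact: (bcf_integrable (bcf_comp pc fb)).
Qed.

(** Such a function vanishes almost everywhere, and the whole space, of mass 1, is not
    negligible. *)
Lemma Rintegral_eq0 (h : X -> R) : bcf h -> (forall x, 0 <= h x) ->
  \int[mu]_x h x = 0 -> exists z, h z = 0.
Proof.
move=> hb h0 ih.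
have mh : measurable_fun [set: borel X] (EFin \o (h : borel X -> R)).
  by apply/measurable_EFinP; apply: continuous_measurable_borel hb.1.
have : (\int[mu]_x `|(EFin \o (h : borel X -> R)) x| = 0)%E.
  rewrite (eq_integral (EFin \o (h : borel X -> R))); last first.
    by move=> x _ /=; rewrite ger0_norm.
  by rewrite -(fineK (integrable_fin_num measurableT (bcf_integrable hb)))
    -[fine _]/(Rintegral mu setT h) ih.
move/(ae_eq_integral_abs mu measurableT mh) => [A [mA A0 sA]].
apply: contrapT => nz.
have AT : A = setT.
  rewrite -subTset => x _; apply: sA => /= e; apply: nz; exists x.
  by have [] := e I.
by have := probability_setT mu; rewrite -AT A0 => /eqP;
  rewrite eqe eq_sym oner_eq0.
Qed.

Lemma Rintegral_sum n (f : 'I_n -> X -> R) : (forall i, bcf (f i)) ->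
  \int[mu]_x (\sum_i f i x) = \sum_i \int[mu]_x f i x.
Proof.
elim: n f => [|n IH] f fb.
  rewrite big_ord0 (_ : (fun x => _) = cst 0) ?Rintegral_cst ?mul0r //.
  by apply/funext => x; rewrite big_ord0.
rewrite big_ord_recl -IH // -RintegralD //; last 2 first.
- exact: bcf_integrable (fb _).
- by apply: (bcf_integrable (f := fun x => \sum_i f (lift ord0 i) x));
    exact: bcf_sum.
by congr (Rintegral _ _ _); apply/funext => x; rewrite big_ord_recl.
Qed.

End BoundedContinuous.

(** * Homogeneous design problems *)

Section Design.
Variables (R : realType) (D : design_problem R).

Lemma dp_W_bcf f : dp_W D f -> bcf f.
Proof.
move=> Wf; split; first exact: dp_W_continuous Wf.
have [B [_ fB]] := dp_W_bounded Wf.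
by exists (B + 1) => x; apply: fB => //; rewrite ltrDl.
Qed.

Lemma dp_V_bcf h : dp_V D h -> bcf h.
Proof.
move=> [[f [c [Wf ->]]] _]; apply: bcfD; [exact: dp_W_bcf|exact: bcf_cst].
Qed.

Lemma homogeneous_map : homogeneous D -> forall x y : D, exists phi : D -> D,
  [/\ continuous phi, measure_preserving (dp_mu D) phi, phi x = y &
      forall h, dp_V D h -> dp_V D (h \o phi)].
Proof.
move=> hom x y; have [phi [[pc _] mp pW pxy]] := hom x y.
exists phi; split=> // h hV; split; last first.
  by have := Rintegral_preserved pc mp (dp_V_bcf hV); rewrite (proj2 hV).
have [[f [c [Wf ->]]] _] := hV.
exists (f \o phi), c; split=> //.
by rewrite -pW; exists f.
Qed.

Variables (M : nat) (b : 'I_M -> D -> R).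
Hypothesis b_free : lin_free b.
Hypothesis b_span : dp_V D = lin_span b.

Lemma dp_V_comb h : dp_V D h <-> exists c : 'rV[R]_M, h = comb b c.
Proof.
have E (c : 'I_M -> R) : \sum_i c i *: b i = comb b (\row_i c i).
  by apply/funext => x; rewrite /comb fct_sumE; apply: eq_bigr => i _;
    rewrite mxE.
rewrite b_span; split=> [[c _ <-]|[c ->]].
  by exists (\row_i c i); rewrite E.
by exists (fun i => c 0 i) => //; rewrite E; congr comb; apply/rowP => i;
  rewrite mxE.
Qed.

Lemma comb_dp_V c : dp_V D (comb b c).
Proof. by apply/dp_V_comb; exists c. Qed.

Lemma comb_eq0 c : (forall x, comb b c x = 0) -> c = 0.
Proof.
move=> c0; apply/rowP => i; rewrite [RHS]mxE;
  apply: (b_free (c := fun i => c 0 i)).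
by apply/funext => x; rewrite -[RHS](c0 x) /comb fct_sumE; apply: eq_bigr.
Qed.

Lemma b_dp_V m : dp_V D (b m).
Proof.
apply/dp_V_comb; exists (delta_mx 0 m); apply/funext => x.
rewrite /comb (bigD1 m) //= mxE !eqxx mul1r big1 ?addr0 // => i /negbTE im.
by rewrite mxE im mul0r.
Qed.

Lemma b_continuous m : continuous (b m).
Proof. exact: (dp_V_bcf (b_dp_V m)).1. Qed.

Lemma b_bounded : exists2 B, 0 <= B & forall m x, `|b m x| <= B.
Proof.
have /choice[B BP] := fun m => (dp_V_bcf (b_dp_V m)).2.
have B0 m : 0 <= B m by apply: le_trans (BP m point).
exists (\sum_m B m) => [|m x]; first exact: sumr_ge0.
by rewrite (le_trans (BP m x)) // (bigD1 m) //= lerDl sumr_ge0.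
Qed.

(* The functions of V that vanish almost everywhere have a common zero, since V
   is finite-dimensional; homogeneity moves it to any point. *)
Lemma dp_V_ge0 h : homogeneous D -> dp_V D h ->
  (forall x, 0 <= h x) -> forall x, h x = 0.
Proof.
move=> hom hV h0.
pose null (c : 'rV[R]_M) := \int[dp_mu D]_x `|comb b c x| = 0.
have cb c : bcf (comb b c) by exact: dp_V_bcf (comb_dp_V c).
have combD c c' a x : comb b (c + a *: c') x = comb b c x + a * comb b c' x.
  rewrite /comb mulr_sumr -big_split /=; apply: eq_bigr => i _.
  by rewrite !mxE mulrDl mulrA.
have int c := bcf_integrable (dp_mu D) (bcf_norm (cb c)).
have nullD c c' a : null c -> null c' -> null (c + a *: c').
  rewrite /null => n1 n2; apply/eqP; rewrite eq_le Rintegral_ge0 // andbT.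
  have intZ := bcf_integrable (dp_mu D) (bcfZ `|a| (bcf_norm (cb c'))).
  apply: (@le_trans _ _
      (\int[dp_mu D]_x (`|comb b c x| + `|a| * `|comb b c' x|))).
    apply: le_Rintegral => //.
      exact: bcf_integrable
        (bcfD (bcf_norm (cb c)) (bcfZ `|a| (bcf_norm (cb c')))).
    by move=> x _; rewrite combD -normrM ler_normD.
  by rewrite RintegralD // RintegralZl // n1 n2 mulr0 addr0.
(* A null subspace of maximal dimension: adding a null vector keeps it null, so it already contains
   them all. *)
have [U [Unull Umax]] : exists U : {vspace 'rV[R]_M},
    (forall c, c \in U -> null c) /\ forall c, null c -> c \in U.
  pose P k := `[< exists U : {vspace 'rV[R]_M},
    (forall c, c \in U -> null c) /\ \dim U = k >].
  have exP : exists k, P k.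
    exists 0%N; apply/asboolP; exists 0%VS; rewrite dimv0; split=> // c.
    rewrite memv0 => /eqP ->;
      rewrite /null (_ : (fun x => _) = cst 0) ?Rintegral_cst ?mul0r //.
    by apply/funext => x; rewrite /comb big1 ?normr0 // => j _;
      rewrite mxE mul0r.
  have leP k : P k -> (k <= \dim (fullv : {vspace 'rV[R]_M}))%N.
    by move=> /asboolP[U [_ <-]]; exact: dimvS (subvf U).
  case: (ex_maxnP exP leP) => k /asboolP[U [Un Uk]] kmax.
  exists U; split=> // c nc.
  have : (\dim (U + <[c]>) <= \dim U)%N.
    rewrite Uk; apply: kmax; apply/asboolP; exists (U + <[c]>)%VS;
      split=> // _ /memv_addP[u uU [_ /vlineP[a ->] ->]].
    by apply: nullD => //; exact: Un.
  rewrite (geq_leqif (dimv_leqif_sup (addvSl U _))).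
  by rewrite memvE => h'; exact: subv_trans (addvSr U _) h'.
(* A zero of [g] is a common zero of a basis of [U], hence of all null combinations. *)
pose g x := \sum_(i < \dim U) `|comb b (vbasis U)`_i x|.
have [z gz] : exists z, g z = 0.
  apply: (@Rintegral_eq0 _ _ (dp_mu D)).
  - by apply: bcf_sum => i; exact: bcf_norm.
  - by move=> x; exact: sumr_ge0.
  - rewrite (Rintegral_sum _ (fun i => bcf_norm (cb _))) big1 // => i _.
    by apply: Unull; apply: vbasis_mem; rewrite mem_nth // size_tuple.
have z0 c : null c -> comb b c z = 0.
  move=> /Umax cU; rewrite (coord_vbasis cU).
  have combs n (a : 'I_n -> R) (v : 'I_n -> 'rV[R]_M) :
      comb b (\sum_i a i *: v i) z = \sum_i a i * comb b (v i) z.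
    rewrite /comb; under [RHS]eq_bigr do rewrite mulr_sumr.
    rewrite exchange_big /=; apply: eq_bigr => m _; rewrite summxE mulr_suml.
    by apply: eq_bigr => i _; rewrite mxE mulrA.
  rewrite combs big1 // => i _.
  have := gz; rewrite /g => /eqP;
    rewrite psumr_eq0 // => /allP/(_ i (mem_index_enum i)).
  by rewrite /= normr_eq0 => /eqP ->; rewrite mulr0.
move=> x; have [phi [pc mp <- phiV]] := homogeneous_map hom z x.
have /dp_V_comb[c hc] := phiV h hV.
rewrite -[LHS]/((h \o phi) z) hc; apply: z0.
rewrite /null -hc (_ : (fun x => _) = h \o phi);
  first by rewrite (Rintegral_preserved pc mp (dp_V_bcf hV)); exact: (proj2 hV).
by apply/funext => y; exact: ger0_norm (h0 _).
Qed.

(** By compactness, failure would give a boundary [f] with [comb b f <= 0] everywhere. Then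
    [dp_V_ge0] applied to [- f] and independence of [b] force [f = 0], which is not on the
    boundary. *)
Lemma comb_lower_bound : homogeneous D -> exists2 s0, 0 < s0 &
  forall f, cube_boundary f -> exists x, s0 <= comb b f x.
Proof.
move=> hom; have [B B0 bB] := b_bounded.
apply: contrapT => no.
have /choice[u uP] : forall n : nat, exists f : 'rV[R]_M, cube_boundary f /\
    forall x, comb b f x < n.+1%:R^-1.
  move=> n; apply: contrapT => nf; apply: no; exists n.+1%:R^-1 => // f fb.
  apply: contrapT => nx; apply: nf; exists f; split=> // x.
  by rewrite ltNge; apply/negP => h; apply: nx; exists x.
have [f [fc cl]] := cube_cluster (fun n => (uP n).1.1).
have [m fm] : exists m, `|f 0 m| = 1.
  apply: contrapT => nb.
  have near1 : nbhs f [set g : 'rV[R]_M | forall m, `|g 0 m| < 1].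
    apply: (@filter_forall _ _ _ (nbhs f) (nbhs_filter f)) => m.
    have fm : `|f 0 m| < 1.
      by rewrite lt_neqAle fc andbT; apply/eqP => e; apply: nb; exists m.
    have := @coord_continuous R 1 M 0 m f.
    move/cvg_norm/(_ [set r | r < 1] (lt_nbhsl fm)).
    exact.
  have [n [_ un]] := cl _ 0%N near1.
  by have [[_ [m um]] _] := uP n; have := un m; rewrite um ltxx.
have f_le0 x : comb b f x <= 0.
  rewrite leNgt; apply/negP => fx.
  (* This makes the Lipschitz error [M * e * B] at most half of [comb b f x]; the [+ 1] keeps the
     denominator positive when [B = 0]. *)
  pose e := comb b f x / (2 * (M%:R * B + 1)).
  have MB : 0 <= M%:R * B by rewrite mulr_ge0.
  have e0 : 0 < e by rewrite divr_gt0 // mulr_gt0 // ltr_wpDl.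
  have fx2 : 0 < comb b f x / 2 by rewrite divr_gt0.
  have [k _ ke] := near_infty_natSinv_lt (PosNum fx2).
  have [n [kn [_ fn]]] := cl _ k (nbhsx_ballx f e e0).
  have ne : n.+1%:R^-1 < comb b f x / 2 := ke n kn.
  have l1 : comb b f x <= comb b (u n) x + M%:R * (e * B).
    by apply: (comb_lipschitz bB) => m'; apply: ltW; exact: (fn 0 m').
  have l2 := (uP n).2 x.
  have l3 : M%:R * (e * B) <= comb b f x / 2.
    rewrite /e; move: (comb b f x) fx => a a0.
    have c0 : 0 < M%:R * B + 1 by rewrite ltr_wpDl.
    have -> : M%:R * (a / (2 * (M%:R * B + 1)) * B) =
      a / 2 * (M%:R * B / (M%:R * B + 1)).
      by field; rewrite gt_eqF.
    rewrite ler_piMr ?divr_ge0 ?(ltW a0) //.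
    by rewrite ler_pdivrMr // mul1r lerDl.
  have l4 := lt_trans l2 ne.
  by move: l1 l3 l4; clear; lra.
have Nf x : comb b (- f) x = - comb b f x.
  by rewrite /comb -sumrN; apply: eq_bigr => i _; rewrite mxE mulNr.
have Nf0 x : 0 <= comb b (- f) x by rewrite Nf oppr_ge0.
have f0 : f = 0.
  apply: comb_eq0 => x; apply: oppr_inj; rewrite oppr0 -Nf.
  exact: dp_V_ge0 hom (comb_dp_V _) Nf0 x.
by move: fm; rewrite f0 mxE normr0 => /esym/eqP; rewrite oner_eq0.
Qed.

(** Subtracting its mean from a function of [W] gives an element of [V], a combination of the
    [b m]. *)
Lemma zero_sum_design N (p : 'I_N -> D) : (0 < N)%N ->
  (forall m, \sum_i b m (p i) = 0) -> is_design p.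
Proof.
move=> N0 pb; split=> // f Wf.
have fb := dp_W_bcf Wf.
pose a := \int[dp_mu D]_x f x.
have hV : dp_V D (fun x => f x + - a).
  split; first by exists f, (- a).
  rewrite RintegralD //; last 2 first.
  - exact: (bcf_integrable _ fb).
  - exact: (bcf_integrable _ (bcf_cst _ (- a))).
  rewrite Rintegral_cst // -/a (_ : fine _ = 1) ?mulr1 ?subrr //.
  transitivity (fine (1%E : \bar R)) => //; congr fine.
  exact: probability_setT.
have /dp_V_comb[c hc] := hV.
have : \sum_i (f (p i) - a) = 0.
  have E x : f x - a = comb b c x by have /(congr1 (fun h => h x)) := hc.
  under eq_bigr do rewrite E; rewrite /comb exchange_big /= big1 // => m _.
  by rewrite -mulr_sumr pb mulr0.
rewrite sumrB sumr_const card_ord => /eqP; rewrite subr_eq0 => /eqP ->.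
by rewrite -[a *+ N]mulr_natl mulKf // pnatr_eq0 -lt0n.
Qed.

(* Homogeneity moves [z i0] to an arbitrary point [x]; if [f <= S], then the
   moved balanced sum gives [l i0 * f x >= - (\sum_i l i - l i0) * S]. *)
Lemma balanced_design k (z : 'I_k -> D) l i0 N : homogeneous D ->
  path_connected R D -> (0 < M)%N -> balanced b z l -> 0 < l i0 ->
  M.-1%:R * (\sum_i l i) < N%:R * l i0 ->
  exists p : 'I_N -> D, is_design p.
Proof.
move=> hom pc M0 [l0 ls lb] li0 hN.
have [B B0 bB] := b_bounded.
have [s0 s00 s0P] := comb_lower_bound hom.
(* Then [1 + kappa] is the inverse of the normalised weight of [z i0]. *)
pose kappa := (\sum_i l i - l i0) / l i0.
have k1 : 1 + kappa = (\sum_i l i) / l i0.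
  by rewrite /kappa mulrBl divff ?gt_eqF // addrC subrK.
have Ll : \sum_(i | i != i0) l i = \sum_i l i - l i0.
  by rewrite [in RHS](bigD1 i0) //= [RHS]addrAC subrr add0r.
have kappa0 : 0 <= kappa by rewrite divr_ge0 ?(ltW li0) // -Ll sumr_ge0.
have hN' : M.-1%:R * (1 + kappa) < N%:R by rewrite k1 mulrA ltr_pdivrMr.
have N0 : (0 < N)%N.
  by rewrite -(ltr_nat R) (le_lt_trans _ hN') // mulr_ge0 // addr_ge0.
have [|p pb] := path_zero_sum (point : D)
  pc b_continuous bB s00 kappa0 M0 s0P _ hN'; last first.
  by exists p; exact: zero_sum_design.
move=> f _ S fS x.
have [phi [_ _ <- phiV]] := homogeneous_map hom (z i0) x.
have /dp_V_comb[c hc] := phiV _ (comb_dp_V f).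
have E y : comb b f (phi y) = comb b c y by have /(congr1 (fun h => h y)) := hc.
have sum0 : \sum_i l i * comb b f (phi (z i)) = 0.
  under eq_bigr do rewrite E /comb mulr_sumr.
  rewrite exchange_big /= big1 // => m _.
  under eq_bigr do rewrite mulrCA.
  by rewrite -mulr_sumr lb mulr0.
have : \sum_(i | i != i0) l i * comb b f (phi (z i)) <= (\sum_i l i - l i0) * S.
  by rewrite -Ll mulr_suml; apply: ler_sum => i _; exact: ler_wpM2l.
move: sum0; rewrite (bigD1 i0) //= => /eqP; rewrite addr_eq0 => /eqP e h.
by rewrite /kappa mulrAC -mulNr ler_pdivrMr // [comb _ _ _ * _]mulrC e lerN2.
Qed.

(** The crude ratio [M * B / s0] already bounds [kappa], so some number of points has zero sum;
    equal weights on them are balanced. *)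
Lemma balanceable_design : homogeneous D -> path_connected R D -> (0 < M)%N ->
  exists k, balanceable b k.
Proof.
move=> hom pc M0.
have [B B0 bB] := b_bounded.
have [s0 s00 s0P] := comb_lower_bound hom.
pose kappa := M%:R * B / s0.
have kappa0 : 0 <= kappa by rewrite divr_ge0 ?mulr_ge0 ?(ltW s00).
pose N := (Num.trunc (M.-1%:R * (1 + kappa))).+1.
have hN : M.-1%:R * (1 + kappa) < N%:R.
  have h : 0 <= M.-1%:R * (1 + kappa) by rewrite mulr_ge0 // addr_ge0.
  by case/andP: (truncn_itv h).
have [|p pb] := path_zero_sum (point : D)
  pc b_continuous bB s00 kappa0 M0 s0P _ hN.
  move=> f fb S fS x.
  have S0 : s0 <= S by have [y] := s0P f fb; move/le_trans; apply; exact: fS.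
  have MB : - (M%:R * B) <= comb b f x.
    rewrite lerNl /comb -sumrN.
    apply: le_trans (_ : \sum_(m < M) B <= _);
      last by rewrite sumr_const card_ord mulr_natl.
    apply: ler_sum => m _; rewrite (le_trans (ler_norm _)) // normrN normrM.
    by rewrite -[B]mul1r ler_pM // fb.1.
  apply: le_trans MB; rewrite lerN2 /kappa mulrAC ler_pdivlMr //.
  by rewrite ler_wpM2l ?mulr_ge0.
exists N, p, (fun=> 1); split=> // [|m].
  by rewrite sumr_const card_ord ltr0n.
by under eq_bigr do rewrite mul1r.
Qed.

End Design.

Theorem theorem10 (R : realType) (D : design_problem R) (M : nat) :
  homogeneous D ->
  path_connected R D ->
  has_dim (dp_V D) M ->
  (1 < M)%N ->
  (forall N : nat, (M * (M - 1) < N)%N ->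
     exists p : 'I_N -> D, is_design p) /\
  (exists N : nat, (N <= M * (M - 1))%N /\
     exists p : 'I_N -> D, is_design p).
Proof.
move=> hom pc [b [b_free b_span]] M1.
have M0 := ltnW M1.
have bc := b_continuous b_span.
have [k0 bk0] := balanceable_design b_free b_span hom pc M0.
have [k kM [z [l bzl]]] := fenchel pc bc M0 bk0.
have [l0 ls lb] := bzl.
have k_gt0 : (0 < k)%N.
  rewrite lt0n; apply: contraTneq ls => kE; rewrite big1 ?ltxx // => j _.
  by have := leq_ltn_trans (leq0n j) (ltn_ord j); rewrite kE.
case: (@arg_maxP _ R _ (Ordinal k_gt0) xpredT l isT) => i0 _ lmax.
have sum_le : \sum_i l i <= k%:R * l i0.
  apply: le_trans (_ : \sum_(i < k) l i0 <= _);
    last by rewrite sumr_const card_ord mulr_natl.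
  by apply: ler_sum => i _; exact: lmax.
have li0 : 0 < l i0.
  by have := lt_le_trans ls sum_le; rewrite pmulr_rgt0 ?ltr0n.
have kl : k%:R * l i0 <= M%:R * l i0 by rewrite ler_pM2r // ler_nat.
have M10 : 0 < M.-1%:R :> R by rewrite ltr0n -subn1 subn_gt0.
have design N := balanced_design b_free b_span (N := N) hom pc M0 bzl li0.
split=> [N hN|].
  apply: design; apply: le_lt_trans (_ : M.-1%:R * (M%:R * l i0) < _).
    by rewrite ler_pM2l // (le_trans sum_le).
  by rewrite mulrA ltr_pM2r // -natrM ltr_nat mulnC -subn1.
(* With equal weights the [k <= M] points themselves form a design. Otherwise the total weight is
   strictly below [M * l i0], and this strictness admits [N = M * (M - 1)]. *)
have [eq|[i li]] : (forall i, l i = l i0) \/ exists i, l i < l i0.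
  have [|nex] := pselect (exists i, l i < l i0); [by right|left=> i].
  apply/eqP; rewrite eq_le; apply/andP; split; first exact: lmax.
  rewrite leNgt; apply/negP => h.
  by apply: nex; exists i.
- exists k; split; first by rewrite (leq_trans kM) // leq_pmulr // subn_gt0.
  exists z; apply: zero_sum_design b_span _ _ _ _ => // m.
  apply: (mulfI (lt0r_neq0 li0)); rewrite mulr0 mulr_sumr -[RHS](lb m).
  by apply: eq_bigr => i _; rewrite eq.
- exists (M * (M - 1))%N; split=> //.
  apply: design; rewrite subn1 mulnC natrM -mulrA ltr_pM2l //
    (lt_le_trans _ kl) //.
  have -> : k%:R * l i0 = \sum_(j < k) l i0.
    by rewrite sumr_const card_ord mulr_natl.
  rewrite (bigD1 i) //= [ltRHS](bigD1 i) //= ltr_leD //.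
  by apply: ler_sum => j _; exact: lmax.
Qed.
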